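(* Consider the deterministic noise setting with noise level $\delta>0$, let $k\ge 1$ be an integer and $\tau\ge 1$. Let $n_*=n_*(\tau)$ be the fast balancing parameter and $n_{opt}$ the optimal parameter (assumed to exist). Assume that $x$ satisfies the Spectral Assumption, and let $0<w_1<1$ and $w_2>1$ be constants (independent of $\delta$) such that for all levels $n$ $$\|x-x_{n+1}\|\le w_1\|x-x_n\| \qquad\text{and}\qquad \rho(n)\le\rho(n+1)\le w_2\,\rho(n).$$ Then $$\|x_{n_*}^\delta-x\|\le C\left(\|x_{n_{opt}}-x\|+\rho(n_{opt})\right),\qquad C=\frac{4\tau+3}{2}\,\min_{1\le\kappa\le k}\left\{\frac{w_2^{\kappa}}{1-w_1^{\kappa}}\right\},$$ where the minimum is over integers $\kappa$; in particular $C$ is independent of $\delta$.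
   Context: **Operator.** $\mathcal X,\mathcal Y$ are separable real infinite-dimensional Hilbert spaces, $A:\mathcal X\to\mathcal Y$ is a compact linear operator with trivial null-space, with singular value decomposition $Ax=\sum_{k=1}^\infty\sigma_k\langle x,u_k\rangle v_k$, where $(u_k)$, $(v_k)$ are orthonormal bases of $\mathcal X$, $\mathcal Y$ and $(\sigma_k)$ is the decreasing sequence of singular values. **Data and Tikhonov regularization.** $x\in\mathcal X$ is the exact solution, $y=Ax$, and $y^\delta=Ax+\xi$ with noise $\xi$. Fix $q_0>0$ and $0<q<1$. For levels $n\in\mathbb N=\{1,2,\dots\}$ put $A_n^{-1}:=(A^*A+q_0q^n I)^{-1}A^*$ (a notation, not an actual inverse), $x_n:=A_n^{-1}y$ and $x_n^\delta:=A_n^{-1}y^\delta$. **Deterministic noise.** $\xi\in\mathcal Y$ with $\|\xi\|\le\delta$; the noise behavior is $\rho(n):=\|A_n^{-1}\|\,\delta$ (which satisfies $\rho(n)\le\delta(q_0q^n)^{-1/2}$). **Spectral Assumption on $x$.** Either $\|(A^*A)^{-1}x\|<\infty$ (i.e. $x$ lies in the range of $A^*A$), or there exist constants $\gamma>0$, $0<\nu<1$, $C_{\gamma,\nu}>0$, $D_{\gamma,\nu}>0$ such that for all $0\le t\le\gamma$ $$D_{\gamma,\nu}^2t^{2\nu}\ \ge\ \sum_{\{k:\ \sigma_k^2\le t\}}\langle x,u_k\rangle^2\ \ge\ C_{\gamma,\nu}^2t^{2\nu}.$$ (Under this assumption a constant $w_1$ as in the claim is known to exist.) **Optimal parameter.**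 $n_{opt}$ is the level such that $\|x_{n_{opt}}-x\|>\rho(n_{opt})$ and $\|x_{n_{opt}+1}-x\|\le\rho(n_{opt}+1)$; its existence is a standing assumption. **Balancing functional and fast balancing.** For an integer $k\ge1$, $$b_k(n):=\max_{n<m\le n+k}\left\{\tfrac14\,\|x_n^\delta-x_m^\delta\|\,\rho(m)^{-1}\right\},$$ and the fast balancing parameter $n_*(\tau)$ is the smallest $n$ with $b_k(n)<\tau$. *)

(* Defs.v *)
From HB Require Import structures.
From mathcomp Require Import all_boot all_order all_algebra sesquilinear.
From mathcomp Require Import all_classical all_reals all_analysis.

Set Implicit Arguments.
Unset Strict Implicit.
Unset Printing Implicit Defensive.

Import Order.TTheory GRing.Theory Num.Theory.
Import numFieldNormedType.Exports.

Local Open Scope classical_set_scope.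
Local Open Scope ring_scope.

HB.mixin Record isHilbert (R : realType) H of CompleteNormedModule R H := {
  inner : {dot H for idfun};
  inner_normE : forall x : H, inner x x = `|x| ^+ 2
}.

#[short(type="hilbertType")]
HB.structure Definition Hilbert (R : realType) :=
  {H of isHilbert R H & CompleteNormedModule R H}.

Definition separable_space (T : topologicalType) : Prop :=
  exists2 D : set T, countable D & dense D.

Definition infinite_dimensional (R : realType) (V : lmodType R) : Prop :=
  forall n : nat, exists e : 'I_n -> V, forall c : 'I_n -> R,
    \sum_(i < n) c i *: e i = 0 -> forall i, c i = 0.

Definition orthonormal_basis (R : realType) (H : hilbertType R)
    (e : nat -> H) : Prop :=
  (forall i j, inner (e i) (e j) = (i == j)%:R) /\
  (forall x : H, series (fun k => inner x (e k) *: e k) @ \oo --> x).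

Definition compact_operator (R : realType) (X Y : normedModType R)
    (A : X -> Y) : Prop :=
  precompact (A @` [set x | `|x| <= 1]).

(* Indices start at 0, so that [sigma 0] is the largest singular value. *)
Definition is_svd (R : realType) (X Y : hilbertType R) (A : X -> Y)
    (sigma : nat -> R) (u : nat -> X) (v : nat -> Y) : Prop :=
  [/\ orthonormal_basis u,
      orthonormal_basis v,
      nonincreasing_seq sigma,
      (forall k, 0 < sigma k)
    & forall x : X,
        series (fun k => (sigma k * inner x (u k)) *: v k) @ \oo --> A x].

Definition operator_norm (R : realType) (X Y : normedModType R)
    (T : X -> Y) : R :=
  sup [set `|T x| | x in [set x | `|x| <= 1]].

(* For bounded linear [A] the element chosen here exists (Riesz) and is unique. *)
Definition adjoint (R : realType) (X Y : hilbertType R) (A : X -> Y)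
    (y : Y) : X :=
  xget 0 [set z | forall x, inner (A x) y = inner x z].

Section Tikhonov.
Context {R : realType} {X Y : hilbertType R}.
Variables (A : X -> Y) (q0 q : R).

Definition normal_operator : X -> X := adjoint A \o A.

(* [pinv] is the genuine inverse here: the shifted operator is bijective
   whenever [A] is bounded linear and [0 < q0 * q ^+ n]. *)
Definition reg_inverse (n : nat) : Y -> X :=
  'pinv_(fun=> 0) setT (fun z => normal_operator z + (q0 * q ^+ n) *: z)
  \o adjoint A.

Definition noise_behavior (delta : R) (n : nat) : R :=
  operator_norm (reg_inverse n) * delta.

End Tikhonov.

Definition spectral_assumption (R : realType) (X Y : hilbertType R)
    (A : X -> Y) (sigma : nat -> R) (u : nat -> X) (x : X) : Prop :=
  range (normal_operator A) x \/
  exists gamma nu C D : R,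
    [/\ 0 < gamma, 0 < nu < 1, 0 < C, 0 < D &
      forall t : R, 0 <= t <= gamma ->
        ((C ^+ 2 * t `^ (2 * nu))%:E
           <= \esum_(k in [set k | (sigma k ^+ 2 <= t)%R])
                (inner x (u k) ^+ 2)%:E
           <= (D ^+ 2 * t `^ (2 * nu))%:E)%E].

Section Balancing.
Context {R : realType} {X : normedModType R}.

Definition is_optimal_parameter (x : X) (xs : nat -> X) (rho : nat -> R)
    (n : nat) : Prop :=
  [/\ (1 <= n)%N, rho n < `|xs n - x| & `|xs n.+1 - x| <= rho n.+1].

(* All the terms are nonnegative, so the neutral element 0 is harmless. *)
Definition balancing_functional (k : nat) (xs : nat -> X) (rho : nat -> R)
    (n : nat) : R :=
  \big[Num.max/0]_(n.+1 <= m < (n + k).+1)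
    (4^-1 * `|xs n - xs m| * (rho m)^-1).

(* Levels start at 1: the default value 0 means that no level qualifies. *)
Definition fast_balancing_parameter (k : nat) (xs : nat -> X)
    (rho : nat -> R) (tau : R) : nat :=
  let b := balancing_functional k xs rho in
  xget 0%N [set n | [/\ (1 <= n)%N, b n < tau
                      & forall m, (1 <= m < n)%N -> tau <= b m]].

End Balancing.

Definition balancing_constant (R : realType) (k : nat) (tau w1 w2 : R) : R :=
  let c kappa := w2 ^+ kappa / (1 - w1 ^+ kappa) in
  (4 * tau + 3) / 2 * \big[Num.min/c 1%N]_(1 <= kappa < k.+1) c kappa.

(* Main.v *)
Require Import Defs.
From mathcomp Require Import all_boot all_order all_algebra.
From mathcomp Require Import all_classical all_reals all_analysis.
From mathcomp Require Import sesquilinear ring lra.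

(** Fast balancing compares a regularized solution only with the next [k]
levels, and the geometric decay of the approximation error makes this enough.
Write [e n] for the norm of [x - xs n].

If [n] passes the balancing test, then for each [kappa] between 1 and [k] the
noisy solutions at levels [n] and [n + kappa] differ by less than
[4 * tau * rho (n + kappa)].  The error decays by the factor [w1 ^+ kappa]
between these levels, so the noise-free solutions differ by at least
[(1 - w1 ^+ kappa) * e n]; what separates the two differences is at most
[rho n + rho (n + kappa)].  As [rho] grows by at most [w2 ^+ kappa], this bounds
[e n] by a multiple of [rho n] ([balanced_error]).

The level [n_opt.+1] passes the test, since the error there is dominated by the
noise and stays so later ([balancing_functional_lt1]); hence
[n_star <= n_opt.+1] ([fast_balancingP]).  If [n_star <= n_opt], then
[rho n_star <= rho n_opt < e n_opt], so [rho n_star] is at most half of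
[e n_opt + rho n_opt], which is where the factor [1 / 2] in the constant comes
from.  If [n_star = n_opt.+1], that half would be lost, but contraction and
growth from [n_opt] to [n_opt.+1] give directly a bound with the constant [w2],
which is smaller than the claimed one.

It remains to see that [rho] is positive and dominates the propagated noise.
This holds because the regularized inverse is a bounded linear operator, acting
diagonally on the singular vectors with the nonzero factors
[sigma k / (sigma k ^+ 2 + q0 * q ^+ n)] ([inner_reg_inverse]).  The adjoint and
the solvability of the regularized normal equation both come from one fact: a
bounded sequence of multipliers defines a bounded diagonal operator between
two orthonormal bases ([diagonal_operator_exists]). *)

Set Implicit Arguments.
Unset Strict Implicit.

Import Order.TTheory GRing.Theory Num.Theory.
Import numFieldNormedType.Exports.

Local Open Scope classical_set_scope.
Local Open Scope ring_scope.

(** * Inner products and orthonormal bases *)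

Section InnerProduct.
Context {R : realType} {H : hilbertType R}.
Implicit Types (x y z : H) (a : R).

Lemma innerC x y : inner x y = inner y x.
Proof. by rewrite hermC/= expr0 mul1r. Qed.

Lemma innerDl x y z : inner (x + y) z = inner x z + inner y z.
Proof. exact: linearDl. Qed.

Lemma innerZl a x z : inner (a *: x) z = a * inner x z.
Proof. exact: linearZl_LR. Qed.

Lemma innerDr x y z : inner z (x + y) = inner z x + inner z y.
Proof. by rewrite innerC innerDl !(innerC _ z). Qed.

Lemma innerZr a x z : inner z (a *: x) = a * inner z x.
Proof. by rewrite innerC innerZl innerC. Qed.

Lemma inner0l z : inner 0 z = 0.
Proof. by rewrite -(scale0r z) innerZl mul0r. Qed.

Lemma inner_suml (I : Type) (r : seq I) (P : pred I) (f : I -> H) z :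
  inner (\sum_(i <- r | P i) f i) z = \sum_(i <- r | P i) inner (f i) z.
Proof.
by apply: (big_morph (fun t => inner t z)) => [a b|]; rewrite ?innerDl ?inner0l.
Qed.

Lemma inner_polarization x y :
  inner x y = 2^-1 * (`|x + y| ^+ 2 - `|x| ^+ 2 - `|y| ^+ 2).
Proof.
rewrite -!inner_normE !innerDl !innerDr (innerC y x).
by set p := inner x y; set a := inner x x; set b := inner y y; field.
Qed.

(** Polarization reduces continuity of the inner product to that of the norm. *)
Lemma cvg_innerl (T : Type) (F : set_system T) {FF : Filter F} (f : T -> H)
    l z :
  f @ F --> l -> inner (f t) z @[t --> F] --> inner l z.
Proof.
move=> fl; rewrite inner_polarization.
under eq_fun do rewrite inner_polarization.
have sqr (g : T -> H) w : g @ F --> w -> `|g t| ^+ 2 @[t --> F] --> `|w| ^+ 2.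
  by move=> gw; rewrite expr2; under eq_fun do rewrite expr2;
    apply: cvgM; exact: cvg_norm.
apply: cvgM; first exact: cvg_cst.
apply: cvgB; last exact: cvg_cst.
by apply: cvgB; apply: sqr => //; apply: cvgD => //; exact: cvg_cst.
Qed.

End InnerProduct.

Section OrthonormalBasis.
Context {R : realType} {H : hilbertType R}.
Variable e : nat -> H.
Hypothesis e_basis : orthonormal_basis e.
Implicit Types (x y z : H) (c : nat -> R).

Lemma inner_sum_basis c (m n k : nat) :
  inner (\sum_(m <= i < n) c i *: e i) (e k) = c k *+ (m <= k < n)%N.
Proof.
rewrite inner_suml.
under eq_bigr do rewrite innerZl (proj1 e_basis).
have [mkn|mkn] := boolP (m <= k < n)%N.
  rewrite (bigD1_seq k)/= ?mem_index_iota ?iota_uniq// eqxx mulr1 big1 ?addr0//.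
  by move=> i /negbTE ->; rewrite mulr0.
rewrite big1_seq// => i /=; rewrite mem_index_iota => imn.
by have [ik|] := eqVneq i k; [rewrite ik (negbTE mkn) in imn|rewrite mulr0].
Qed.

Lemma norm_sum_basis c (m n : nat) :
  `|\sum_(m <= i < n) c i *: e i| ^+ 2 = \sum_(m <= i < n) c i ^+ 2.
Proof.
rewrite -inner_normE {1}inner_suml; apply: eq_big_nat => i imn.
by rewrite innerZl innerC inner_sum_basis imn mulr1n expr2.
Qed.

(** The coefficients of the partial sums are eventually constant. *)
Lemma inner_series_basis c z : series (fun k => c k *: e k) @ \oo --> z ->
  forall k, inner z (e k) = c k.
Proof.
move=> cz k; apply: (norm_cvg_unique (cvg_innerl (z := e k) cz)).
apply: cvg_near_cst; near=> n.
rewrite inner_sum_basis leq0n/= (_ : (k < n)%N = true) ?mulr1n//.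
by near: n; exact: nbhs_infty_gt.
Unshelve. all: by end_near. Qed.

Lemma inner_basis_inj x y : (forall k, inner x (e k) = inner y (e k)) -> x = y.
Proof.
move=> xy; have cx := proj2 e_basis x.
have xyE : (fun k => inner x (e k) *: e k) = (fun k => inner y (e k) *: e k).
  by apply/funext => k; rewrite xy.
by rewrite xyE in cx; exact: norm_cvg_unique cx (proj2 e_basis y).
Qed.

Lemma cvg_series_inner x y :
  series (fun k => inner x (e k) * inner y (e k)) @ \oo --> inner x y.
Proof.
have sumE : series (fun k => inner x (e k) * inner y (e k)) =
    (fun n => inner (series (fun k => inner x (e k) *: e k) n) y).
  apply/funext => n; rewrite inner_suml; apply: eq_bigr => i _.
  by rewrite innerZl (innerC (e i)).
by rewrite sumE; exact: cvg_innerl (proj2 e_basis x).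
Qed.

End OrthonormalBasis.

(** * Diagonal operators *)

Section DiagonalOperator.
Context {R : realType} {X Y : hilbertType R}.
Variables (u : nat -> X) (v : nat -> Y).
Hypotheses (u_basis : orthonormal_basis u) (v_basis : orthonormal_basis v).

(** By Pythagoras, each block of the series defining [z] is at most [M] times the
corresponding block of the expansion of [y]; hence the partial sums are Cauchy,
and the same comparison on initial blocks bounds the norm of the limit. *)
Lemma diagonal_operator_exists (mu : nat -> R) (M : R) (y : Y) :
  (forall k, `|mu k| <= M) ->
  exists2 z : X, (forall k, inner z (u k) = mu k * inner y (v k)) &
    `|z| <= M * `|y|.
Proof.
move=> muM; have M0 : 0 <= M by exact: le_trans (muM 0%N).
pose c k := mu k * inner y (v k).
have sum_le m n : `|\sum_(m <= i < n) c i *: u i| <=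
    M * `|\sum_(m <= i < n) inner y (v i) *: v i|.
  rewrite -(ler_pXn2r (n := 2)) ?nnegrE ?mulr_ge0// exprMn.
  rewrite (norm_sum_basis u_basis) (norm_sum_basis v_basis) mulr_sumr.
  apply: ler_sum => i _; rewrite exprMn ler_wpM2r ?sqr_ge0//.
  by rewrite -real_normK ?num_real// ler_pXn2r ?nnegrE.
have /cvgP/cauchy_cvgP/cauchy_seriesP y_cauchy := proj2 v_basis y.
have /cauchy_cvg : cauchy (series (fun k => c k *: u k) @ \oo).
  apply/cauchy_seriesP => eps eps0.
  have M1 : 0 < M + 1 by rewrite ltr_wpDl.
  have := y_cauchy _ (divr_gt0 eps0 M1); apply: filterS => n /= n_lt.
  apply: le_lt_trans (sum_le _ _) _.
  have := n_lt; rewrite ltr_pdivlMr// mulrC; apply: le_lt_trans.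
  by rewrite ler_wpM2r// lerDl.
move=> /cvg_ex[z cz]; exists z; first exact: inner_series_basis cz.
apply: ler_cvg_to (cvg_norm cz) _ _.
  by apply: cvgM; [exact: cvg_cst | exact: cvg_norm (proj2 v_basis y)].
by apply: nearW => n; exact: sum_le.
Qed.

End DiagonalOperator.

(** * Operator norms *)

Section OperatorNorm.
Context {R : realType} {X Y : normedModType R}.
Variables (T : X -> Y) (M : R).
Hypotheses (T_homogeneous : forall a x, T (a *: x) = a *: T x)
           (T_bounded : forall x, `|T x| <= M * `|x|).

(** The bound on [T] makes the supremum genuine: the supremum of an unbounded set
has the conventional value 0. *)
Lemma le_operator_norm x : `|T x| <= operator_norm T * `|x|.
Proof.
have [->|x0] := eqVneq x 0.
  by have := T_homogeneous 0 0; rewrite !scale0r => ->; rewrite !normr0 mulr0.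
rewrite -ler_pdivrMr ?normr_gt0//.
apply: ub_le_sup.
  exists `|M| => _ [z /= z1 <-]; apply: le_trans (T_bounded z) _.
  apply: le_trans (ler_norm _) _.
  by rewrite normrM normr_id ler_piMr.
exists (`|x|^-1 *: x);
  first by rewrite /= normrZ normfV normr_id mulVf ?normr_eq0.
by rewrite T_homogeneous normrZ normfV normr_id mulrC.
Qed.

Lemma operator_norm_gt0 x : T x != 0 -> 0 < operator_norm T.
Proof.
move=> Tx; rewrite -(@pmulr_lgt0 _ `|x|).
  by apply: lt_le_trans (le_operator_norm x); rewrite normr_gt0.
rewrite normr_gt0; apply: contraNneq Tx => ->.
by have := T_homogeneous 0 0; rewrite !scale0r => ->.
Qed.

End OperatorNorm.

(** * The regularized inverse in the singular basis *)

Section RegularizedInverse.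
Context {R : realType} {X Y : hilbertType R}.
Variables (A : X -> Y) (sigma : nat -> R) (u : nat -> X) (v : nat -> Y).
Hypothesis A_svd : is_svd A sigma u v.

Let u_basis : orthonormal_basis u. Proof. by case: A_svd. Qed.
Let v_basis : orthonormal_basis v. Proof. by case: A_svd. Qed.
Let sigma_gt0 k : 0 < sigma k. Proof. by case: A_svd. Qed.
Let sigma_le0 k : sigma k <= sigma 0%N.
Proof. by case: A_svd => _ _ /(_ 0%N k (leq0n k)). Qed.

Lemma inner_svd z k : inner (A z) (v k) = sigma k * inner z (u k).
Proof. by case: A_svd => _ _ _ _ /(_ z)/(inner_series_basis v_basis)->. Qed.

Lemma svd_singular_vector k : A (u k) = sigma k *: v k.
Proof.
apply: (inner_basis_inj v_basis) => j.
rewrite inner_svd innerZl (proj1 u_basis) (proj1 v_basis).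
by have [->|] := eqVneq k j; rewrite // !mulr0.
Qed.

(** The diagonal operator with multipliers [sigma] satisfies the defining
identity of the adjoint, so the choice operator returns a vector satisfying it;
testing that vector against [u k] gives the coefficient. *)
Lemma inner_adjoint y k : inner (adjoint A y) (u k) = sigma k * inner y (v k).
Proof.
have [|z zE _] := @diagonal_operator_exists _ _ _ _ _ u_basis v_basis
  sigma (sigma 0%N) y.
  by move=> j; rewrite gtr0_norm.
have Az : [set w | forall x, inner (A x) y = inner x w] z.
  move=> x; have cx := cvg_series_inner v_basis (x := A x) (y := y).
  have termE : (fun k => inner (A x) (v k) * inner y (v k)) =
      (fun k => inner x (u k) * inner z (u k)).
    by apply/funext => j; rewrite zE inner_svd mulrCA mulrA.
  by rewrite termE in cx;
    exact: norm_cvg_unique cx (cvg_series_inner u_basis (x := x) (y := z)).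
rewrite /adjoint; have := xgetI (0 : X) Az; set w := xget _ _ => /(_ (u k)).
by rewrite svd_singular_vector innerZl (innerC (v k)) (innerC (u k)) => ->.
Qed.

Lemma inner_normal_operator z k :
  inner (normal_operator A z) (u k) = sigma k ^+ 2 * inner z (u k).
Proof. by rewrite inner_adjoint inner_svd mulrA expr2. Qed.

Variables (q0 q : R).
Hypotheses (q0_gt0 : 0 < q0) (q_gt0 : 0 < q).

Let filter_factor n k := sigma k / (sigma k ^+ 2 + q0 * q ^+ n).

Let alpha_gt0 n : 0 < q0 * q ^+ n. Proof. by rewrite mulr_gt0 ?exprn_gt0. Qed.

Let den_gt0 n k : 0 < sigma k ^+ 2 + q0 * q ^+ n.
Proof. by rewrite addr_gt0 ?exprn_gt0. Qed.

Let filter_factor_gt0 n k : 0 < filter_factor n k.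
Proof. by rewrite divr_gt0. Qed.

Let filter_factor_le n k : `|filter_factor n k| <= sigma 0%N / (q0 * q ^+ n).
Proof.
rewrite gtr0_norm// ler_pM ?invr_ge0 ?(ltW (den_gt0 _ _))
  ?(ltW (sigma_gt0 _))//.
by rewrite lef_pV2 ?posrE// lerDr sqr_ge0.
Qed.

(** The regularized normal equation is solved by a diagonal operator, so the
right-hand side is in the range on which the chosen inverse is an actual right
inverse; comparing coefficients then determines the value. *)
Lemma inner_reg_inverse n y k :
  inner (reg_inverse A q0 q n y) (u k) = filter_factor n k * inner y (v k).
Proof.
rewrite /reg_inverse/=; set f := (fun z : X => _ + _); set p := 'pinv_ _ _ _ _.
have fE z j : inner (f z) (u j) = (sigma j ^+ 2 + q0 * q ^+ n) * inner z (u j).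
  by rewrite /f innerDl inner_normal_operator innerZl mulrDl.
have [z zE _] :=
  diagonal_operator_exists u_basis v_basis y (filter_factor_le n).
have fz : f z = adjoint A y.
  apply: (inner_basis_inj u_basis) => j.
  rewrite fE zE inner_adjoint /filter_factor mulrA mulrCA.
  by rewrite divff ?mulr1 ?gt_eqF.
have fp : f p = adjoint A y by apply: pinvK; rewrite inE; exists z.
have := fE p k; rewrite fp inner_adjoint /filter_factor => pE.
by rewrite mulrAC pE mulrAC divff ?mul1r ?gt_eqF.
Qed.

Lemma reg_inverseD n y1 y2 :
  reg_inverse A q0 q n (y1 + y2) =
  reg_inverse A q0 q n y1 + reg_inverse A q0 q n y2.
Proof.
apply: (inner_basis_inj u_basis) => k.
by rewrite innerDl !inner_reg_inverse innerDl mulrDr.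
Qed.

Lemma reg_inverseZ n a y :
  reg_inverse A q0 q n (a *: y) = a *: reg_inverse A q0 q n y.
Proof.
apply: (inner_basis_inj u_basis) => k.
by rewrite innerZl !inner_reg_inverse innerZl mulrCA.
Qed.

Lemma reg_inverse_bounded n y :
  `|reg_inverse A q0 q n y| <= sigma 0%N / (q0 * q ^+ n) * `|y|.
Proof.
have [z zE] := diagonal_operator_exists u_basis v_basis y (filter_factor_le n).
suff -> : reg_inverse A q0 q n y = z by [].
by apply: (inner_basis_inj u_basis) => k; rewrite zE inner_reg_inverse.
Qed.

Lemma noise_behavior_gt0 delta n :
  0 < delta -> 0 < noise_behavior A q0 q delta n.
Proof.
move=> delta0; rewrite mulr_gt0//.
apply: (operator_norm_gt0 (reg_inverseZ n) (reg_inverse_bounded n)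
  (x := v 0%N)).
apply/eqP => v0; have := inner_reg_inverse n (v 0%N) 0%N.
rewrite v0 inner0l (proj1 v_basis) eqxx mulr1 => /esym/eqP.
by rewrite gt_eqF.
Qed.

Lemma reg_inverse_noise delta (y xi : Y) n : `|xi| <= delta ->
  `|reg_inverse A q0 q n (y + xi) - reg_inverse A q0 q n y| <=
  noise_behavior A q0 q delta n.
Proof.
move=> xi_le; rewrite reg_inverseD addrC addKr.
have le_norm :=
  le_operator_norm (reg_inverseZ n) (reg_inverse_bounded n).
apply: le_trans (le_norm xi) _; rewrite ler_wpM2l//.
(* The operator norm is nonnegative: it bounds the image of a unit vector. *)
have v1 : `|v 0%N| = 1.
  by apply/eqP; rewrite -sqrp_eq1// -inner_normE (proj1 v_basis) eqxx.
by have := le_norm (v 0%N); rewrite v1 mulr1; apply: le_trans.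
Qed.

End RegularizedInverse.

(** * Error analysis of fast balancing *)

Section FastBalancing.
Context {R : realType} {X : normedModType R}.
Variables (x : X) (xs xs_delta : nat -> X) (rho : nat -> R) (w1 w2 tau : R).
Variables (k n_opt : nat).
Hypotheses (rho_gt0 : forall n, 0 < rho n)
  (noise_le : forall n, `|xs_delta n - xs n| <= rho n)
  (w1_bounds : 0 < w1 < 1) (w2_gt1 : 1 < w2)
  (xs_contract : forall n, (1 <= n)%N -> `|x - xs n.+1| <= w1 * `|x - xs n|)
  (rho_growth : forall n, (1 <= n)%N -> rho n <= rho n.+1 <= w2 * rho n)
  (tau_ge1 : 1 <= tau).

Lemma error_geometric n m : (1 <= n)%N ->
  `|x - xs (n + m)%N| <= w1 ^+ m * `|x - xs n|.
Proof.
have /andP[w1_gt0 _] := w1_bounds.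
move=> n1; elim: m => [|m IH]; first by rewrite addn0 mul1r.
rewrite addnS exprS -mulrA.
apply: le_trans (xs_contract _) _; first by rewrite addn_gt0 n1.
by rewrite ler_wpM2l// ltW.
Qed.

Lemma rho_nondecreasing n m : (1 <= n)%N -> rho n <= rho (n + m)%N.
Proof.
move=> n1; elim: m => [|m IH]; first by rewrite addn0.
rewrite addnS; apply: le_trans IH _.
by have /andP[] := rho_growth (n := (n + m)%N) (ltn_addr _ n1).
Qed.

Lemma rho_geometric n m : (1 <= n)%N -> rho (n + m)%N <= w2 ^+ m * rho n.
Proof.
have w2_ge0 : 0 <= w2 by rewrite (le_trans ler01)// ltW.
move=> n1; elim: m => [|m IH]; first by rewrite addn0 mul1r.
rewrite addnS exprS -mulrA.
have /andP[_ /le_trans] := rho_growth (n := (n + m)%N) (ltn_addr _ n1); apply.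
by rewrite ler_wpM2l.
Qed.

(** Once the error is dominated by the noise, two later noisy solutions differ by
at most four copies of the noise of the higher level, whence the factor [1 / 4]
in the balancing functional.  The inequality is strict because the error at the
higher level has contracted. *)
Lemma balancing_functional_lt1 n : (1 <= n)%N -> `|xs n - x| <= rho n ->
  balancing_functional k xs_delta rho n < 1.
Proof.
move=> n1; rewrite distrC => en; have /andP[w1_gt0 w1_lt1] := w1_bounds.
rewrite /balancing_functional big_nat_cond; elim/big_ind: _ => //.
  by move=> a b a1 b1; rewrite gt_max a1 b1.
move=> m; rewrite andbT => /andP[nm _].
have [p mE] : exists p, m = (n + p.+1)%N.
  by exists (m - n.+1)%N; rewrite addnS -addSn subnKC.
rewrite mE ltr_pdivrMr// mul1r ltr_pdivrMl//.
have em := error_geometric p.+1 n1.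
have rm := rho_nondecreasing p.+1 n1.
have w_lt1 : w1 ^+ p.+1 < 1 by rewrite exprn_ilt1 ?ltW.
have em' : `|x - xs (n + p.+1)%N| < rho (n + p.+1)%N.
  apply: le_lt_trans em _; apply: le_lt_trans (ler_wpM2l _ en) _.
    by rewrite exprn_ge0 ?ltW.
  by apply: lt_le_trans rm; rewrite gtr_pMl.
have := noise_le n; have := noise_le (n + p.+1)%N.
move: em' rm; set m' := (n + p.+1)%N => em' rm Nm Nn.
have := ler_distD (xs n) (xs_delta n) (xs_delta m').
have := ler_distD x (xs n) (xs_delta m').
have := ler_distD (xs m') x (xs_delta m').
rewrite (distrC (xs n) x) (distrC (xs m') (xs_delta m')).
lra.
Qed.

Lemma fast_balancingP : is_optimal_parameter x xs rho n_opt ->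
  let n_star := fast_balancing_parameter k xs_delta rho tau in
  (1 <= n_star <= n_opt.+1)%N /\
  balancing_functional k xs_delta rho n_star < tau.
Proof.
move=> [n_opt1 _ opt_le] /=.
set b := balancing_functional k xs_delta rho.
have b_opt : b n_opt.+1 < tau.
  exact: lt_le_trans (balancing_functional_lt1 _ opt_le) tau_ge1.
pose P n := (1 <= n)%N && (b n < tau).
have P_ex : exists n, P n by exists n_opt.+1.
have in_set : exists n : nat, [/\ (1 <= n)%N, b n < tau
    & forall m, (1 <= m < n)%N -> tau <= b m].
  case: (ex_minnP P_ex) => n /andP[n1 bn] n_min; exists n; split=> // m.
  move=> /andP[m1 mn]; rewrite leNgt; apply/negP => bm.
  by have := n_min m; rewrite /P m1 bm leqNgt mn => /(_ isT).
have [n_star1 b_star star_min] := xgetPex 0%N in_set.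
rewrite /fast_balancing_parameter n_star1 b_star; split=> //=.
rewrite leqNgt; apply/negP => star_gt.
by have := star_min n_opt.+1 star_gt; rewrite leNgt b_opt.
Qed.

(** The error at [n] is recovered from the difference of levels [n] and
[n + kappa] because the error has contracted by [w1 ^+ kappa] in between. *)
Lemma balanced_error n kappa : (1 <= n)%N -> (1 <= kappa <= k)%N ->
  balancing_functional k xs_delta rho n < tau ->
  `|xs_delta n - x| <=
    (4 * tau + 3) * (w2 ^+ kappa / (1 - w1 ^+ kappa)) * rho n.
Proof.
move=> n1 /andP[kappa1 kappa_le] bn; have /andP[w1_gt0 w1_lt1] := w1_bounds.
have w_gt0 : 0 < w1 ^+ kappa by exact: exprn_gt0.
have w_lt1 : w1 ^+ kappa < 1 by rewrite exprn_ilt1 ?(ltW w1_gt0) -?lt0n.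
have W_ge1 : 1 <= w2 ^+ kappa by rewrite exprn_ege1// ltW.
have rho_le := rho_geometric kappa n1.
have rho_ge := rho_nondecreasing kappa n1.
have err := error_geometric kappa n1.
have Nn := noise_le n.
have Nm := noise_le (n + kappa)%N.
have m_in : (n + kappa)%N \in index_iota n.+1 (n + k).+1.
  by rewrite mem_index_iota -addn1 leq_add2l kappa1/= ltnS leq_add2l.
have bm : `|xs_delta n - xs_delta (n + kappa)%N| < 4 * tau * rho (n + kappa)%N.
  have := le_lt_trans (@le_bigmax_seq _ _ _ _ 0 (n + kappa)%N predT
    (fun m => 4^-1 * `|xs_delta n - xs_delta m| * (rho m)^-1) m_in isT) bn.
  by rewrite ltr_pdivrMr// ltr_pdivrMl// mulrA.
move: (n + kappa)%N rho_le rho_ge err Nm bm {m_in} => m rho_le rho_ge err Nm bm.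
move: (w1 ^+ kappa) (w2 ^+ kappa) w_gt0 w_lt1 W_ge1 rho_le err.
move=> w W w_gt0 w_lt1 W_ge1 rho_le err.
have rn := rho_gt0 n.
have e_le : (1 - w) * `|x - xs n| <= (4 * tau + 2) * (W * rho n).
  have := ler_distD (xs m) x (xs n).
  have := ler_distD (xs_delta m) (xs m) (xs n).
  have := ler_distD (xs_delta n) (xs_delta m) (xs n).
  rewrite (distrC (xs m) (xs_delta m)) (distrC (xs_delta m) (xs_delta n)).
  have : tau * rho m <= tau * (W * rho n).
    by rewrite ler_wpM2l// (le_trans ler01).
  lra.
rewrite mulrA mulrAC ler_pdivlMr ?subr_gt0// mulrC.
apply: (@le_trans _ _ ((1 - w) * (rho n + `|x - xs n|))).
  rewrite ler_wpM2l ?subr_ge0 ?(ltW w_lt1)//.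
  apply: le_trans (ler_distD (xs n) _ _) _.
  by rewrite (distrC (xs n) x) lerD2r.
rewrite mulrDr; have : (1 - w) * rho n <= W * rho n.
  by rewrite ler_wpM2r ?(ltW rn)//; lra.
lra.
Qed.

Theorem fast_balancing_error_bound :
  (1 <= k)%N -> is_optimal_parameter x xs rho n_opt ->
  `|xs_delta (fast_balancing_parameter k xs_delta rho tau) - x| <=
    balancing_constant k tau w1 w2 * (`|xs n_opt - x| + rho n_opt).
Proof.
move=> k1 opt; have [/andP[]] := fast_balancingP opt.
move: (fast_balancing_parameter _ _ _ _) => n n1 n_le b_lt.
have [n_opt1 opt_gt _] := opt; have rn := rho_gt0 n_opt.
have /andP[w1_gt0 w1_lt1] := w1_bounds.
have t_ge1 := tau_ge1; have w2_1 := w2_gt1.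
pose c kappa := w2 ^+ kappa / (1 - w1 ^+ kappa).
have bound kappa : (1 <= kappa <= k)%N ->
    `|xs_delta n - x| <=
      (4 * tau + 3) / 2 * c kappa * (`|xs n_opt - x| + rho n_opt).
  move=> kappa_k.
  have w_gt0 : 0 < w1 ^+ kappa by exact: exprn_gt0.
  have w_lt1 : w1 ^+ kappa < 1.
    by rewrite exprn_ilt1 ?(ltW w1_gt0) -?lt0n//; case/andP: kappa_k.
  have W_ge : w2 <= w2 ^+ kappa.
    by rewrite -[leLHS]expr1 ler_weXn2l ?(ltW w2_gt1)//; case/andP: kappa_k.
  have c_ge : w2 <= c kappa.
    rewrite ler_pdivlMr ?subr_gt0//; apply: le_trans W_ge.
    by rewrite ler_piMr ?gerBl ?(ltW w_gt0)// (le_trans ler01)// ltW.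
  have c_ge0 : 0 <= c kappa.
    by rewrite (le_trans _ c_ge)// (le_trans ler01)// ltW.
  have := balanced_error n1 kappa_k b_lt; rewrite -/(c kappa).
  move: (c kappa) c_ge c_ge0 => C c_ge c_ge0 balanced.
  (* For n <= n_opt, rho n is at most half of the right-hand sum; the remaining
     case n = n_opt.+1 follows from one step of contraction and growth. *)
  move: n_le; rewrite leq_eqVlt => /predU1P[n_eq|]; last first.
    rewrite ltnS => n_le.
    apply: le_trans balanced _.
    have rho_le : rho n <= rho n_opt.
      by rewrite -(subnKC n_le) rho_nondecreasing.
    have -> : (4 * tau + 3) / 2 * C * (`|xs n_opt - x| + rho n_opt) =
        (4 * tau + 3) * C * ((`|xs n_opt - x| + rho n_opt) / 2) by field.
    by apply: ler_wpM2l; [apply: mulr_ge0 c_ge0; lra | lra].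
  rewrite n_eq; apply: le_trans (ler_distD (xs n_opt.+1) _ _) _.
  have /andP[_ rho_le] := rho_growth n_opt1.
  have := noise_le n_opt.+1.
  have := xs_contract n_opt1; rewrite !(distrC x).
  move: opt_gt; set e := `|xs n_opt - x| => opt_gt err noise.
  have : w1 * e <= w2 * e by rewrite ler_wpM2r ?normr_ge0//; lra.
  have e_gt0 : 0 < e + rho n_opt by rewrite addr_gt0// (lt_trans rn).
  have : w2 * (e + rho n_opt) <= C * (e + rho n_opt) by rewrite ler_pM2r.
  rewrite -mulrA => wS we; apply: (@le_trans _ _ (C * (e + rho n_opt))).
    lra.
  rewrite ler_peMl//; last by lra.
  by rewrite mulr_ge0 ?(ltW e_gt0).
rewrite /balancing_constant -/c.
rewrite -ler_pdivrMr; last by rewrite addr_gt0// (lt_trans rn).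
(* A bound valid for each kappa passes to their minimum. *)
rewrite big_nat_cond; elim/big_ind: _ => [|a b Ha Hb|kappa].
- rewrite ler_pdivrMr; last by rewrite addr_gt0// (lt_trans rn).
  exact: bound.
- by rewrite /Num.min/Order.min; case: ifP.
- rewrite andbT ltnS => kappa_k.
  rewrite ler_pdivrMr; last by rewrite addr_gt0// (lt_trans rn).
  exact: bound.
Qed.

End FastBalancing.

Unset Implicit Arguments.
Set Strict Implicit.

Theorem theorem4p1 (R : realType) (X Y : hilbertType R)
    (X_separable : separable_space X) (X_infinite : infinite_dimensional X)
    (Y_separable : separable_space Y) (Y_infinite : infinite_dimensional Y)
    (A : {linear X -> Y}) (A_compact : compact_operator A)
    (A_null_space : forall z, A z = 0 -> z = 0)
    (sigma : nat -> R) (u : nat -> X) (v : nat -> Y)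
    (A_svd : is_svd A sigma u v)
    (q0 q : R) (q0_gt0 : 0 < q0) (q_bounds : 0 < q < 1)
    (x : X) (x_spectral : spectral_assumption A sigma u x)
    (k : nat) (k_ge1 : (1 <= k)%N) (tau : R) (tau_ge1 : 1 <= tau)
    (w1 w2 : R) (w1_bounds : 0 < w1 < 1) (w2_gt1 : 1 < w2)
    (delta : R) (delta_gt0 : 0 < delta)
    (xi : Y) (xi_le : `|xi| <= delta) :
  let xs := fun n => reg_inverse A q0 q n (A x) in
  let xs_delta := fun n => reg_inverse A q0 q n (A x + xi) in
  let rho := noise_behavior A q0 q delta in
  (forall n, (1 <= n)%N -> `|x - xs n.+1| <= w1 * `|x - xs n|) ->
  (forall n, (1 <= n)%N -> rho n <= rho n.+1 <= w2 * rho n) ->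
  forall n_opt : nat, is_optimal_parameter x xs rho n_opt ->
  let n_star := fast_balancing_parameter k xs_delta rho tau in
  `|xs_delta n_star - x| <=
    balancing_constant k tau w1 w2 * (`|xs n_opt - x| + rho n_opt).
Proof.
move=> xs xs_delta rho xs_contract rho_growth n_opt opt.
have q_gt0 : 0 < q by case/andP: q_bounds.
have rho_gt0 n : 0 < rho n by exact: (noise_behavior_gt0 A_svd q0_gt0 q_gt0).
have noise_le n : `|xs_delta n - xs n| <= rho n.
  exact: (reg_inverse_noise A_svd q0_gt0 q_gt0 (A x) n xi_le).
exact: (fast_balancing_error_bound rho_gt0 noise_le w1_bounds w2_gt1
  xs_contract rho_growth tau_ge1 k_ge1 opt).
Qed.
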